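(* Let $X$ be a topological space and $L$ a locale. Let $g\colon \mathbb{O}(X)\to L$ be a locale map and let $\pi\colon X\to \mathrm{pt}(L)$ be a continuous map that are adjuncts of each other. If $\pi$ is an open surjection and $L$ is spatial, then $g$ is open and surjective. Conversely, assume that $g$ is open and surjective and that (1) $\mathrm{pt}(L)$ is first countable (which holds when $X$ is second countable), and (2) all closed subspaces of $X$ are Baire spaces. Then $\pi$ is open and surjective and $L$ is spatial.
   Context: A frame is a complete lattice with $J\wedge\bigvee_{s\in S} I_s=\bigvee_{s\in S}(J\wedge I_s)$ for all families (top $1$, bottom $0$); a frame homomorphism preserves arbitrary joins and finite meets (in particular $0$ and $1$). A locale is the same thing as a frame, and a locale map $g\colon L\to R$ is a frame homomorphism $g^*\colon R\to L$ in the opposite direction. For a topological space $X$, $\mathbb{O}(X)$ is the locale of open subsets of $X$. For a locale $L$, $\mathrm{pt}(L)$ is the set of prime elements of $L$, that is, elements $p\neq 1$ such that $I_1\wedge I_2\le p$ implies $I_1\le p$ or $I_2\le p$, with the topology consisting of the sets $U_I=\{p\in\mathrm{pt}(L): I\not\le p\}$, $I\in L$. $L$ is spatial if the map $L\to\mathbb{O}(\mathrm{pt}(L))$, $I\mapsto U_I$, is injective. A locale map $g\colon\mathbb{O}(X)\to L$ (i.e. a frame homomorphism $g^*\colon L\to\mathbb{O}(X)$) and a continuous map $\pi\colon X\to\mathrm{pt}(L)$ are adjuncts of each other if $g^*(I)=\pi^{-1}(U_I)$ for all $I\in L$; this gives a bijection between locale maps $\mathbb{O}(X)\to L$ and continuous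 maps $X\to\mathrm{pt}(L)$. A locale map $g\colon L\to R$ is open if $g^*\colon R\to L$ has a left adjoint $g_!\colon L\to R$ (i.e. $g_!(J)\le I\iff J\le g^*(I)$) with $g_!(J\wedge g^*(I))=g_!(J)\wedge I$ for all $I\in R$, $J\in L$. An open locale map $g$ is surjective if $g^*$ is injective. A Baire space is a space in which countable intersections of dense open subsets are dense. *)

(* Defs.v *)
From HB Require Import structures.
From mathcomp Require Import all_boot all_order all_classical.
From mathcomp Require Import topology_structure subtype_topology.

Set Implicit Arguments.
Unset Strict Implicit.
Unset Printing Implicit Defensive.

Import Order.TTheory.

Local Open Scope classical_set_scope.

HB.mixin Record TBLattice_isFrame d T of Order.TBLattice d T := {
  fsup : set T -> T;
  fsup_isLub : forall S : set T, isLub S (fsup S);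
  meet_fsup : forall (J : T) (S : set T),
    (J `&` fsup S)%O = fsup [set (J `&` I)%O | I in S]
}.

#[short(type="frameType")]
HB.structure Definition Frame d :=
  {T of TBLattice_isFrame d T & Order.TBLattice d T}.

HB.mixin Record isSupMorphism d (R : frameType d) d' (L : frameType d')
    (f : R -> L) := {
  omorph_fsup : forall S : set R, f (fsup S) = fsup (f @` S)
}.

(* Preservation of the bottom is the case S = set0 of omorph_fsup. *)
HB.structure Definition FrameHom d (R : frameType d) d' (L : frameType d') :=
  {f of isSupMorphism d R d' L f & @Order.MeetLatticeMorphism d R d' L f
      & @Order.TLatticeMorphism d R d' L f}.

(* A locale map L -> R is a frame homomorphism R -> L: as a function,
   g : locale_map L R is g^*. *)
Definition locale_map d d' (L : frameType d) (R : frameType d') :=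
  @FrameHom.type d' R d L.

Section Opens.
Context {X : topologicalType}.

Record opens := Opens {
  opens_val :> set X;
  _ : `[< open opens_val >]
}.

HB.instance Definition _ := [isSub for opens_val].
HB.instance Definition _ := [Choice of opens by <:].

Let opens_meet (U V : set X) :
  `[< open U >] -> `[< open V >] -> `[< open (U `&` V)%O >].
Proof. by move=> /asboolP oU /asboolP oV; apply/asboolP/openI. Qed.

Let opens_join (U V : set X) :
  `[< open U >] -> `[< open V >] -> `[< open (U `|` V)%O >].
Proof. by move=> /asboolP oU /asboolP oV; apply/asboolP/openU. Qed.

Let opens_bot : `[< open (\bot%O : set X) >].
Proof. exact/asboolP/open0. Qed.

Let opens_top : `[< open (\top%O : set X) >].
Proof. exact/asboolP/openT. Qed.

HB.instance Definition _ :=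
  Order.SubChoice_isTBSubLattice.Build set_display (set X)
    (fun U => `[< open U >]) set_display opens
    opens_meet opens_join opens_bot opens_top.

Lemma opensP (U : opens) : open U.
Proof. exact/asboolP/(valP U). Qed.

Lemma opens_leE (U V : opens) : (U <= V)%O = (U `<=` V) :> Prop.
Proof. by rewrite -subsetEset. Qed.

Lemma opens_meetE (U V : opens) :
  opens_val (U `&` V)%O = opens_val U `&` opens_val V.
Proof. by []. Qed.

Let sup_subproof (S : set opens) :
  `[< open (\bigcup_(U in S) (U : set X)) >].
Proof. by apply/asboolP/bigcup_open => U _; exact: opensP. Qed.

Definition opens_sup (S : set opens) : opens := Opens (sup_subproof S).

Let opens_sup_isLub (S : set opens) : isLub S (opens_sup S).
Proof.
split=> [U SU|V ubV]; rewrite opens_leE.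
  by move=> x Ux; exists U.
move=> x [U SU Ux]; have := ubV _ SU; rewrite opens_leE; exact.
Qed.

Let opens_meet_sup (J : opens) (S : set opens) :
  (J `&` opens_sup S)%O = opens_sup [set (J `&` I)%O | I in S].
Proof.
apply: val_inj; rewrite /= meetEset setI_bigcupr bigcup_image.
exact: eq_bigcupr.
Qed.

HB.instance Definition _ :=
  TBLattice_isFrame.Build set_display opens opens_sup_isLub opens_meet_sup.

End Opens.
Arguments opens X : clear implicits.

Section Points.
Context {d : Order.disp_t} {L : frameType d}.

Definition prime_element (p : L) : Prop :=
  p != \top%O /\
  forall I1 I2 : L, (I1 `&` I2 <= p)%O -> (I1 <= p)%O \/ (I2 <= p)%O.

Record pt := Pt {
  pt_val : L;
  _ : `[< prime_element pt_val >]
}.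

HB.instance Definition _ := [isSub for pt_val].
HB.instance Definition _ := [Choice of pt by <:].

Definition pt_open (I : L) : set pt := [set p | ~ (I <= pt_val p)%O].

Let ptP (p : pt) : prime_element (pt_val p).
Proof. exact/asboolP/(valP p). Qed.

Let pt_openT : range pt_open setT.
Proof.
exists \top%O => //; apply/seteqP; split=> // p _ /=.
by rewrite /pt_open /= le1x; have [/negP] := ptP p.
Qed.

Let pt_openI : setI_closed (range pt_open).
Proof.
move=> _ _ [I _ <-] [J _ <-]; exists (I `&` J)%O => //.
apply/seteqP; split=> p /=; rewrite /pt_open /=.
  move=> nIJ; split=> le; apply: nIJ.
    exact: leIxl.
  exact: leIxr.
by move=> [nI nJ] /(proj2 (ptP p))[].
Qed.

Let pt_open_bigU (K : Type) (f : K -> set pt) :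
  (forall k, range pt_open (f k)) -> range pt_open (\bigcup_k f k).
Proof.
move=> rf; pose S := [set I | exists k, f k = pt_open I].
exists (fsup S) => //; have [ubS lubS] := fsup_isLub S.
apply/seteqP; split=> p /=; rewrite /pt_open /=.
  move=> nS; apply: contrapT => nf; apply: nS; apply: lubS => I [k fkE].
  apply: contrapT => nI; apply: nf; exists k => //.
  by rewrite fkE.
move=> [k _ fkp] le; have [I _ fkE] := rf k.
move: fkp; rewrite -fkE; apply; apply: le_trans le.
by apply: ubS; exists k.
Qed.

HB.instance Definition _ :=
  isOpenTopological.Build pt pt_openT pt_openI pt_open_bigU.

Lemma open_pt_open (I : L) : `[< open (pt_open I) >].
Proof. by apply/asboolP; exists I. Qed.

Definition pt_opens (I : L) : opens pt := Opens (open_pt_open I).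

End Points.
Arguments pt {d} L.

Definition spatial d (L : frameType d) := injective (@pt_opens d L).

Definition adjuncts (X : topologicalType) d (L : frameType d)
    (g : locale_map (opens X) L) (pi : X -> pt L) :=
  forall I : L, g I = pi @^-1` pt_open I :> set X.

(* g_ is the left adjoint g_! of g^*. *)
Definition open_locale_map d d' (L : frameType d) (R : frameType d')
    (g : locale_map L R) :=
  exists g_ : L -> R,
    (forall (J : L) (I : R), (g_ J <= I)%O <-> (J <= g I)%O) /\
    (forall (J : L) (I : R), g_ (J `&` g I)%O = (g_ J `&` I)%O).

Definition surjective_locale_map d d' (L : frameType d) (R : frameType d')
    (g : locale_map L R) := injective (g : R -> L).

Definition open_map (X Y : topologicalType) (f : X -> Y) :=
  forall U : set X, open U -> open (f @` U).

Definition first_countable (T : topologicalType) :=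
  forall x : T, exists2 B : set (set T), countable B &
    B `<=` nbhs x /\ forall V, nbhs x V -> exists2 U, B U & U `<=` V.

Definition Baire_space (T : topologicalType) :=
  forall F : nat -> set T, (forall n, open (F n)) -> (forall n, dense (F n)) ->
    dense (\bigcap_n F n).

(* Main.v *)
Require Import Defs.
From HB Require Import structures.
From mathcomp Require Import all_boot all_order all_classical.
From mathcomp Require Import topology_structure subtype_topology.

Import Order.TTheory.

Local Open Scope classical_set_scope.

(** Write [U_I] for [pt_open I], and [g_!] for the left adjoint of [g].

    If [pi] is an open surjection and [L] is spatial, then [I |-> U_I]
    identifies [L] with the opens of [pt L] and [g] with the preimage under
    [pi]; the left adjoint is then the direct image under [pi], its Frobenius
    law is [pi (A `&` pi^-1 B) = pi A `&` B], and preimage under a surjection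
    is injective.

    In the other direction, spatiality is immediate, because [g] factors
    through [I |-> U_I]. The heart of the matter is to lift a point [p] of [L]
    to [X] ([open_locale_map_lift]): if [g_! U] is not below [p], then some
    [x] in [U] satisfies [pi x = p]. Such an [x] must lie in the closed set
    [C], the complement of [g p], and in [g I] for all [I] not below [p].
    Since [p] is prime, the Frobenius law makes every such [g I] dense in [C]
    ([lift_dense]); a countable neighbourhood base at [p] reduces the family of
    all [g I] to a countable one, and the Baire property of [C] provides [x].
    The lifting lemma says that [pi] maps [U] onto [U_(g_! U)], so [pi] is
    open, and the case [U = X] is surjectivity.

    First countability of [pt L] for a second countable [X] holds because
    [g_!] sends a base of [X] to a base of [L]: [I = g_! (g I)], and [g_!]
    preserves joins. *)

(** * Points of a frame *)

Section Points.
Context {d : Order.disp_t} {L : frameType d}.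
Implicit Types (I J : L) (p : pt L).

Lemma pt_prime p : prime_element (pt_val p).
Proof. exact/asboolP/(valP p). Qed.

Lemma le_pt_open I J : (I <= J)%O -> pt_open I `<=` pt_open J.
Proof. by move=> IJ p nIp Jp; apply: nIp; exact: le_trans Jp. Qed.

Lemma pt_open_meet I J : pt_open (I `&` J)%O = pt_open I `&` pt_open J.
Proof.
apply/seteqP; split=> [p pIJ|p [nI nJ] /(proj2 (pt_prime p))[]//].
by split; apply: le_pt_open pIJ; [exact: leIl|exact: leIr].
Qed.

Lemma pt_opens_inj I J : spatial L -> pt_open I = pt_open J -> I = J.
Proof. by move=> spL IJ; apply: spL; exact: val_inj. Qed.

Lemma spatial_le I J : spatial L -> pt_open I `<=` pt_open J -> (I <= J)%O.
Proof.
move=> spL IJ; apply/meet_idPl/pt_opens_inj => //.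
by rewrite pt_open_meet; exact/setIidPl.
Qed.

End Points.

(** * Left adjoints and bases *)

Section LeftAdjoint.
Context {X : topologicalType} {d : Order.disp_t} {L : frameType d}.
Variables (g : locale_map (opens X) L) (g_ : opens X -> L).
Hypothesis g_adj : forall U I, (g_ U <= I)%O <-> (U <= g I)%O.
Implicit Types (U : opens X) (I : L).

(** In any adjunction [g (g_ (g I)) = g I], so an injective [g] forces
    [g_ (g I) = I]. *)
Lemma left_adjointK : surjective_locale_map g -> cancel g g_.
Proof.
move=> ginj I; apply: ginj; apply: le_anti; apply/andP.
by split; [apply: omorph_le|]; exact/g_adj.
Qed.

(** The images [g_ U] of the basic opens [U] generate [L] under joins: [g I] is
    the union of the basic opens inside it, and [I = g_ (g I)]. *)
Lemma left_adjoint_second_countable :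
  surjective_locale_map g -> @second_countable X -> first_countable (pt L).
Proof.
move=> ginj [B cB [oB nB]] p.
pose W U := pt_open (g_ U).
exists [set A | nbhs p A /\ exists2 U : opens X, B U & A = W U].
  apply: (@sub_countable _ _ _ B) => //.
  (* Basic opens are sets, not elements of [opens X]; the default \bot in
     insubd is never reached, because every member of [B] is open. *)
  have sub : [set A | nbhs p A /\ exists2 U : opens X, B U & A = W U]
      `<=` (fun A => pt_open (g_ (insubd (\bot%O : opens X) A))) @` B.
    move=> _ [_ [U BU ->]]; exists (U : set X) => //.
    by rewrite (valKd (\bot%O : opens X) U).
  exact: card_le_trans (subset_card_le sub) (card_image_le _ _).
split=> [A []//|V]; rewrite nbhsE => -[_ [[I _ <-] /= nIp] IV].
have [U [BU Ug nUp]] : exists U : opens X,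
    [/\ B U, (U <= g I)%O & ~ (g_ U <= pt_val p)%O].
  (* Otherwise every basic open inside [g I] lies in [g p], so [g I] does. *)
  apply: contrapT => nU; apply: nIp.
  rewrite -(left_adjointK ginj I); apply/g_adj; rewrite opens_leE => x gIx.
  have [A [BA Ax] AgI] : filter_from [set U | B U /\ U x] id (g I).
    have gIn : nbhs x (g I : set X).
      exact: open_nbhs_nbhs (conj (opensP _) gIx).
    exact: nB gIn.
  have oA : `[< open A >] by apply/asboolP/oB.
  have AgI' : (Opens oA <= g I)%O by rewrite opens_leE.
  have : (Opens oA <= g (pt_val p))%O.
    by apply/g_adj; apply: contrapT => nA; apply: nU; exists (Opens oA).
  by rewrite opens_leE; exact.
exists (W U); last first.
  apply: subset_trans IV; apply: le_pt_open; exact/g_adj.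
split; last by exists U.
by exists (W U) => //; split=> //; exists (g_ U).
Qed.

End LeftAdjoint.

Section Adjuncts.
Context {X : topologicalType} {d : Order.disp_t} {L : frameType d}.
Variables (g : locale_map (opens X) L) (pi : X -> pt L).
Hypothesis g_pi : adjuncts g pi.
Implicit Types (U : opens X) (I : L) (p : pt L).

(** * From the continuous map to the locale map *)

(** The left adjoint sends [U] to the element whose open set of points is the
    image of [U]; spatiality turns inclusions and equalities between open sets
    of points into the corresponding relations in [L]. *)
Lemma image_open_locale_map : open_map pi -> spatial L -> open_locale_map g.
Proof.
move=> pi_open spL.
have /choice[g_ g_E] U : exists I, pt_open I = pi @` (U : set X).
  by have [I _ IE] := pi_open _ (opensP U); exists I.
exists g_; split=> [U I|U I].
  rewrite opens_leE g_pi; split=> [/le_pt_open|].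
    by rewrite g_E => /image_subP.
  by move=> UI; apply: spatial_le => //; rewrite g_E; exact/image_subP.
apply: pt_opens_inj => //; rewrite pt_open_meet !g_E opens_meetE g_pi.
apply/seteqP; split=> [_ [x [Ux Ix] <-]|_ [[x Ux <-] Ix]].
  by split=> //; exists x.
by exists x.
Qed.

Lemma surjection_surjective_locale_map :
  range pi = setT -> spatial L -> surjective_locale_map g.
Proof.
move=> pi_surj spL I J gIJ; apply: pt_opens_inj => //.
have /(congr1 (image^~ pi)) : pi @^-1` pt_open I = pi @^-1` pt_open J.
  by rewrite -!g_pi gIJ.
by rewrite !image_preimage.
Qed.

(** * From the locale map to the continuous map *)

(** An injective [g] factors through [pt_open], its values being preimages of
    the sets [pt_open I]; so [pt_open] is injective too. *)
Lemma surjective_locale_map_spatial : surjective_locale_map g -> spatial L.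
Proof.
move=> ginj I J IJ; apply: ginj; apply: val_inj => /=.
by rewrite !g_pi; have /= -> := congr1 opens_val IJ.
Qed.

Variable g_ : opens X -> L.
Hypothesis g_adj : forall U I, (g_ U <= I)%O <-> (U <= g I)%O.
Hypothesis g_frobenius : forall U I, g_ (U `&` g I)%O = (g_ U `&` I)%O.

(** An open [U] meets the complement of [g p] exactly when [g_ U] is not
    below [p]; by the Frobenius law and primality of [p] this is inherited by
    [U `&` g I] when [I] is not below [p]. *)
Lemma lift_dense U I p : ~ (g_ U <= pt_val p)%O -> ~ (I <= pt_val p)%O ->
  exists x, [/\ (U : set X) x, (g I : set X) x & ~ (g (pt_val p) : set X) x].
Proof.
move=> nU nI; apply: contrapT => nx.
have /(proj2 (pt_prime p))[] // : (g_ U `&` I <= pt_val p)%O.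
rewrite -g_frobenius; apply/g_adj; rewrite opens_leE => x [Ux gIx].
by apply: contrapT => ngp; apply: nx; exists x.
Qed.

(** The Baire property is applied to the traces on the complement [C] of [g p]
    of the preimages of a countable neighbourhood base at [p]. A point [x] in
    all of them satisfies [p <= pi x] because it avoids [g p], and [pi x <= p]
    because it lies in [g I] for every [I] not below [p]. *)
Lemma open_locale_map_lift U p :
  first_countable (pt L) ->
  Baire_space (set_type (~` (g (pt_val p) : set X))) ->
  ~ (g_ U <= pt_val p)%O -> exists2 x, (U : set X) x & pi x = p.
Proof.
move=> fcL; set C := ~` _ => baireC nU.
have [B cB [Bnbhs Bbase]] := fcL p.
have [e eB] : exists e : nat -> set (pt L), e @` setT = B.
  have /pfcard_geP[B0|[e]] := cB; last by exists e; exact: image_eq.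
  by have [V] := Bbase _ filterT; rewrite B0.
(* The members of the base need not be open; their interiors are used. *)
pose F n : set C := (fun c => pi (set_val c)) @^-1` (e n)°.
have oF n : open (F n).
  have [I _ IE] := open_interior (e n).
  by exists (g I : set X); [exact: opensP|rewrite /F -IE g_pi].
have dF n : dense (F n).
  move=> _ /[swap] -[V oV <-] [c Vc].
  have oV' : `[< open V >] by exact/asboolP.
  have [I _ IE] := open_interior (e n).
  have nI : ~ (I <= pt_val p)%O.
    have : pt_open I p by rewrite IE; apply: Bnbhs; rewrite -eB; exists n.
    by [].
  have nV : ~ (g_ (Opens oV') <= pt_val p)%O.
    move/g_adj; rewrite opens_leE => /(_ _ Vc).
    by have := set_valP c.
  have [x [Vx gIx Cx]] := lift_dense _ _ _ nV nI.
  exists (SigSub (mem_set (Cx : C x))); split=> //.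
  by move: gIx; rewrite g_pi IE.
(* Density is applied to the trace of [U] on [C], so this trace has to be
   nonempty. *)
have [y [Uy gpy]] : exists y, (U : set X) y /\ C y.
  apply: contrapT => ny; apply: nU; apply/g_adj; rewrite opens_leE => y Uy.
  by apply: contrapT => ngp; apply: ny; exists y.
have [||x [Ux Fx]] := baireC F oF dF (set_val @^-1` (U : set X)).
- by exists (SigSub (mem_set (gpy : C y))).
- by exists (U : set X); first exact: opensP.
exists (set_val x) => //; apply: val_inj; apply: le_anti; apply/andP; split.
  apply: contrapT => nle.
  have : nbhs p (pt_open (pt_val (pi (set_val x)))).
    by apply: open_nbhs_nbhs; split=> //; exists (pt_val (pi (set_val x))).
  move=> /Bbase[A BA AI].
  move: BA; rewrite -eB => -[n _ enA].
  have := interior_subset (Fx n I); rewrite enA => /AI.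
  exact.
apply: contrapT => nle; have := set_valP x; apply.
by rewrite g_pi.
Qed.

(** The adjunction alone gives the inclusion from left to right; lifting points
    gives the other one. *)
Lemma open_locale_map_image U :
  first_countable (pt L) ->
  (forall C : set X, closed C -> Baire_space (set_type C)) ->
  pi @` (U : set X) = pt_open (g_ U).
Proof.
move=> fcL baireX; apply/seteqP; split=> [_ [x Ux <-]|p nUp].
  have : (U <= g (g_ U))%O by exact/g_adj.
  by rewrite opens_leE g_pi; exact.
have [|x Ux <-] := open_locale_map_lift U p fcL _ nUp; last by exists x.
by apply: baireX; apply: open_closedC; exact: opensP.
Qed.

End Adjuncts.

Theorem theorem3p7 (X : topologicalType) (d : Order.disp_t) (L : frameType d)
    (g : locale_map (opens X) L) (pi : X -> pt L)
    (pi_cont : continuous pi) (g_pi : adjuncts g pi) :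
  (open_map pi -> range pi = setT -> spatial L ->
     open_locale_map g /\ surjective_locale_map g) /\
  (open_locale_map g -> surjective_locale_map g ->
     (@second_countable X -> first_countable (pt L)) /\
     (first_countable (pt L) ->
      (forall C : set X, closed C -> Baire_space (set_type C)) ->
        open_map pi /\ range pi = setT /\ spatial L)).
Proof.
split=> [pi_open pi_surj spL|[g_ [g_adj g_frob]] g_inj].
  split; first exact: image_open_locale_map g_pi pi_open spL.
  exact: surjection_surjective_locale_map g_pi pi_surj spL.
split; first exact: left_adjoint_second_countable g_adj g_inj.
move=> fcL baireX.
have pi_image (U : opens X) : pi @` (U : set X) = pt_open (g_ U).
  exact: (@open_locale_map_image _ _ _ g).
split=> [U oU|].
  have oU' : `[< open U >] by exact/asboolP.
  by rewrite (pi_image (Opens oU')); exists (g_ (Opens oU')).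
split; last exact: surjective_locale_map_spatial g_pi g_inj.
(* Every prime lies in [pt_open \top], and [\top = g_ (g \top)] is [g_] of
   the whole space. *)
have := pi_image (g \top%O); rewrite (left_adjointK _ _ g_adj g_inj).
rewrite omorph1 /= => ->; apply/seteqP; split=> // p _.
by rewrite /pt_open /= le1x; have [/negP] := pt_prime p.
Qed.
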